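(* For $n\ge 1$ let $f_n=f_n(x)$ be the I-generating function of the standard projection $T(2,n)$ of the $(2,n)$-torus link. Then for all $n\ge 4$, $$f_n-f_{n-1}-x f_{n-2}=-2x^2 .$$
   Context: A link projection is a regular projection of a link on $S^2$ whose only intersections are transverse double points, called crossings. Regions are the connected components of the complement of the projection in $S^2$. Two distinct regions are connected if they share a crossing on their boundaries, and disconnected otherwise. A set $W$ of regions is isolated if any two distinct regions in $W$ are disconnected (the empty set is isolated). The I-generating function of a link projection $L$ is the polynomial $f(L)=\sum_{W}x^{|W|}$, where the sum runs over all isolated sets $W$ of regions of $L$. The standard projection $T(2,n)$ of the $(2,n)$-torus link is the projection of the closure of the 2-braid $\sigma_1^n$: it has $n$ crossings and $n+2$ regions. For $n\ge 2$ these are $n$ bigons arranged cyclically, each lying between two cyclically consecutive crossings, and two $n$-gons, each having all $n$ crossings on its boundary. *)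

(* Defs.v *)
From HB Require Import structures.
From mathcomp Require Import all_boot all_order all_algebra finmap.
From mathcomp Require Import all_classical all_reals all_analysis.
From mathcomp Require Import ring lra.

Set Implicit Arguments.
Unset Strict Implicit.
Unset Printing Implicit Defensive.

Import Order.TTheory GRing.Theory Num.Theory.
Import numFieldNormedType.Exports.

Local Open Scope classical_set_scope.
Local Open Scope ring_scope.

Definition sphere2 (R : realType) : set 'rV[R]_3 :=
  [set p | \sum_i p ord0 i ^+ 2 = 1].

(* The relative topology of the sphere is used through the ambient space:
   connectedness is intrinsic, and sphere2 is closed, so that the closure of a
   subset in sphere2 is its closure in R^3. *)
Definition frontier (R : realType) (U : set 'rV[R]_3) : set 'rV[R]_3 :=
  closure U `&` closure (@sphere2 R `\` U).

(* The points of a disjoint union of m circles R/Z. *)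
Definition parameters (R : realType) (m : nat) : set ('I_m * R) :=
  [set p | 0 <= p.2 < 1].
Arguments parameters : clear implicits.

(* A link projection: finitely many C^1-immersed closed curves on the sphere,
   given as 1-periodic maps, that meet only in transverse double points. *)
Record link_projection (R : realType) := LinkProjection {
  components : nat;
  curve : 'I_components -> R -> 'rV[R]_3;
  components_gt0 : (0 < components)%N;
  curve_sphere : forall i t, @sphere2 R (curve i t);
  curve_periodic : forall i, periodic (curve i) 1;
  curve_derivable : forall i t, derivable (curve i) t 1;
  curve_continuous_derive : forall i, continuous (derive1 (curve i));
  curve_immersion : forall i t, derive1 (curve i) t != 0;
  curve_transverse : forall p q, parameters R components p ->
    parameters R components q -> p <> q ->
    curve p.1 p.2 = curve q.1 q.2 ->
    free [:: derive1 (curve p.1) p.2; derive1 (curve q.1) q.2];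
  curve_no_triple : forall p q r, parameters R components p ->
    parameters R components q -> parameters R components r ->
    p <> q -> p <> r -> q <> r ->
    ~ (curve p.1 p.2 = curve q.1 q.2 /\ curve p.1 p.2 = curve r.1 r.2)
}.
Arguments curve {R} L i t : rename.

Section Regions.
Variables (R : realType) (L : link_projection R).

Definition shadow : set 'rV[R]_3 :=
  [set x | exists i, range (curve L i) x].

Definition crossing : set 'rV[R]_3 :=
  [set c | exists p q, [/\ parameters R (components L) p,
     parameters R (components L) q, p <> q,
     curve L p.1 p.2 = c & curve L q.1 q.2 = c]].

Definition regions : set (set 'rV[R]_3) :=
  [set connected_component (@sphere2 R `\` shadow) x
     | x in @sphere2 R `\` shadow].

Definition share_crossing (U V : set 'rV[R]_3) : Prop :=
  exists c, [/\ crossing c, frontier U c & frontier V c].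

Definition isolated : set {fset (set 'rV[R]_3)} :=
  [set W : {fset (set 'rV[R]_3)} | [set` W] `<=` regions /\
     forall U V, U \in W -> V \in W -> U <> V -> ~ share_crossing U V].

(* A link projection has finitely many regions, so this sum is finite. *)
Definition I_generating : {poly int} :=
  \sum_(W \in isolated) ('X : {poly int}) ^+ #|` W|%fset.

End Regions.

Section TorusProjection.
Variable R : realType.
Implicit Types (n : nat) (s t theta phi : R).

(* The point of the sphere with longitude theta and latitude phi. *)
Definition geographic theta phi : 'rV[R]_3 :=
  \row_i [:: cos phi * cos theta; cos phi * sin theta; sin phi]`_i.

(* The closure of the 2-braid sigma_1^n, drawn around the equator: at longitude
   theta the two strands are at latitudes +sin(n theta / 2) and
   -sin(n theta / 2), which are swapped at each of the n crossings, where
   n theta / 2 is a multiple of pi.  If n is even each of the two strands closes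
   up after one turn; if n is odd they form a single curve which closes up after
   two turns. *)
Definition torus_longitude n t : R := pi *+ 2 *+ (odd n).+1 * t.

Definition torus_latitude n (i : nat) t : R :=
  (-1) ^+ i * sin (n%:R / 2 * torus_longitude n t).

Definition torus_curve n (i : 'I_(~~ odd n).+1) t : 'rV[R]_3 :=
  geographic (torus_longitude n t) (torus_latitude n i t).


Definition geographic_velocity theta phi dtheta dphi : 'rV[R]_3 :=
  \row_i [:: - (dphi * sin phi * cos theta) - dtheta * cos phi * sin theta;
             dtheta * cos phi * cos theta - dphi * sin phi * sin theta;
             dphi * cos phi]`_i.

Lemma sphere2_geographic theta phi : @sphere2 R (geographic theta phi).
Proof.
rewrite /sphere2 /= !big_ord_recl big_ord0 !mxE /= addr0.
rewrite addrA !exprMn -mulrDr cos2Dsin2 mulr1; exact: cos2Dsin2.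
Qed.

Lemma is_derive_geographic (th ph : R -> R) t a b :
  is_derive t 1 th a -> is_derive t 1 ph b ->
  is_derive t 1 (fun u => geographic (th u) (ph u))
    (geographic_velocity (th t) (ph t) a b).
Proof.
move=> dth dph.
have dct : is_derive t 1 (fun u => cos (th u)) (a * - sin (th t)).
  by apply: is_derive_eq (is_derive1_comp _ _) _; rewrite mulrC.
have dst : is_derive t 1 (fun u => sin (th u)) (a * cos (th t)).
  by apply: is_derive_eq (is_derive1_comp _ _) _; rewrite mulrC.
have dcp : is_derive t 1 (fun u => cos (ph u)) (b * - sin (ph t)).
  by apply: is_derive_eq (is_derive1_comp _ _) _; rewrite mulrC.
have dsp : is_derive t 1 (fun u => sin (ph u)) (b * cos (ph t)).
  by apply: is_derive_eq (is_derive1_comp _ _) _; rewrite mulrC.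
have dc i : is_derive t 1
    (fun u => geographic (th u) (ph u) ord0 i)
    (geographic_velocity (th t) (ph t) a b ord0 i).
  case: i => -[|[|[|//]]] lti /=.
  - have -> : (fun u => geographic (th u) (ph u) ord0 (Ordinal lti)) =
        (fun u => cos (ph u)) \* (fun u => cos (th u)).
      by apply/funext => u; rewrite !mxE.
    by apply: is_derive_eq (is_deriveM _ _) _; rewrite !mxE /= /GRing.scale /=; ring.
  - have -> : (fun u => geographic (th u) (ph u) ord0 (Ordinal lti)) =
        (fun u => cos (ph u)) \* (fun u => sin (th u)).
      by apply/funext => u; rewrite !mxE.
    by apply: is_derive_eq (is_deriveM _ _) _; rewrite !mxE /= /GRing.scale /=; ring.
  - have -> : (fun u => geographic (th u) (ph u) ord0 (Ordinal lti)) =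
        (fun u => sin (ph u)).
      by apply/funext => u; rewrite !mxE.
    by apply: is_derive_eq; rewrite !mxE.
have D : derivable (fun u => geographic (th u) (ph u)) t 1.
  by apply/derivable_mxP => i j; rewrite (ord1 i); apply: (@ex_derive _ _ _ _ _ _ _ (dc j)).
apply: DeriveDef => //.
by rewrite derive_mx //; apply/rowP => j; rewrite mxE (@derive_val _ _ _ _ _ _ _ (dc j)).
Qed.

Lemma is_derive_torus_longitude n t :
  is_derive t 1 (torus_longitude n) (pi *+ 2 *+ (odd n).+1).
Proof.
rewrite /torus_longitude.
have -> : (fun t => pi *+ 2 *+ (odd n).+1 * t) =
  (pi *+ 2 *+ (odd n).+1 : R) \*: (@id R) by [].
by apply: is_derive_eq; rewrite /GRing.scale /= mulr1.
Qed.

Definition torus_latitude_velocity n (i : nat) t : R :=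
  (-1) ^+ i * (n%:R / 2 * (pi *+ 2 *+ (odd n).+1)
    * cos (n%:R / 2 * torus_longitude n t)).

Lemma is_derive_angle n t :
  is_derive t 1 (fun u => n%:R / 2 * torus_longitude n u)
    (n%:R / 2 * (pi *+ 2 *+ (odd n).+1)).
Proof.
have ? := is_derive_torus_longitude n t.
have -> : (fun u => n%:R / 2 * torus_longitude n u) =
  (n%:R / 2 : R) \*: (torus_longitude n) by [].
exact: is_deriveZ.
Qed.

Lemma is_derive_torus_latitude n i t :
  is_derive t 1 (torus_latitude n i) (torus_latitude_velocity n i t).
Proof.
have ? := is_derive_angle n t.
rewrite /torus_latitude.
have -> : (fun t => (-1) ^+ i * sin (n%:R / 2 * torus_longitude n t)) =
  ((-1) ^+ i : R) \*: (sin \o (fun t => n%:R / 2 * torus_longitude n t)) by [].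
apply: is_derive_eq (is_deriveZ _ _) _.
by rewrite /GRing.scale /= /torus_latitude_velocity; ring.
Qed.

Definition torus_velocity n (i : nat) t : 'rV[R]_3 :=
  geographic_velocity (torus_longitude n t) (torus_latitude n i t)
    (pi *+ 2 *+ (odd n).+1) (torus_latitude_velocity n i t).

Lemma is_derive_torus_curve n i t :
  is_derive t 1 (@torus_curve n i) (torus_velocity n i t).
Proof.
apply: is_derive_geographic.
  exact: is_derive_torus_longitude.
exact: is_derive_torus_latitude.
Qed.

Lemma derive1_torus_curve n i : derive1 (@torus_curve n i) = torus_velocity n i.
Proof.
apply/funext => t.
by rewrite derive1E (@derive_val _ _ _ _ _ _ _ (is_derive_torus_curve i t)).
Qed.

Lemma ord3_ind (P : 'I_3 -> Prop) :
  P (@Ordinal 3 0 isT) -> P (@Ordinal 3 1 isT) -> P (@Ordinal 3 2 isT) ->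
  forall j, P j.
Proof.
move=> P0 P1 P2 -[[|[|[|//]]] ltj].
- by rewrite (_ : Ordinal ltj = Ordinal (isT : 0 < 3)%N) //; exact: val_inj.
- by rewrite (_ : Ordinal ltj = Ordinal (isT : 1 < 3)%N) //; exact: val_inj.
- by rewrite (_ : Ordinal ltj = Ordinal (isT : 2 < 3)%N) //; exact: val_inj.
Qed.

Lemma continuous_derive1_torus_curve n i :
  continuous (derive1 (@torus_curve n i)).
Proof.
rewrite derive1_torus_curve => t.
apply: differentiable_continuous; apply/derivable1_diffP/derivable_mxP => k j.
rewrite (ord1 k) {k}.
have dth := is_derive_torus_longitude n t.
have dph := is_derive_torus_latitude n i t.
have dan := is_derive_angle n t.
have dct : derivable (cos \o torus_longitude n) t 1.
  by apply: ex_derive.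
have dst : derivable (sin \o torus_longitude n) t 1.
  by apply: ex_derive.
have dcp : derivable (cos \o torus_latitude n i) t 1.
  by apply: ex_derive.
have dsp : derivable (sin \o torus_latitude n i) t 1.
  by apply: ex_derive.
have dv : derivable (torus_latitude_velocity n i) t 1.
  have -> : torus_latitude_velocity n i =
    ((-1) ^+ i * (n%:R / 2 * (pi *+ 2 *+ (odd n).+1)) : R) \*:
    (cos \o (fun u => n%:R / 2 * torus_longitude n u)).
    by apply/funext => u; rewrite /torus_latitude_velocity !fctE /= /GRing.scale /=; ring.
  by apply: derivableZ; apply: ex_derive.
pose lat := torus_latitude n i; pose lon := torus_longitude n.
pose vel := torus_latitude_velocity n i; pose k : R := pi *+ 2 *+ (odd n).+1.
have fE (f g : R -> R) : (fun u => f u * g u) = f * g by [].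
have gE (f g : R -> R) : (fun u => f u - g u) = f - g by [].
have oE (f : R -> R) : (fun u => - f u) = - f by [].
have dM (f g : R -> R) : derivable f t 1 -> derivable g t 1 ->
    derivable (fun u => f u * g u) t 1 by rewrite fE; exact: derivableM.
have dB (f g : R -> R) : derivable f t 1 -> derivable g t 1 ->
    derivable (fun u => f u - g u) t 1 by rewrite gE; exact: derivableB.
have dN (f : R -> R) : derivable f t 1 ->
    derivable (fun u => - f u) t 1 by rewrite oE; exact: derivableN.
have dK : derivable (fun=> k : R) t 1 by exact: derivable_cst.
elim/ord3_ind: j.
- have -> : (fun u => torus_velocity n i u ord0 (@Ordinal 3 0 isT)) =
    (fun u => - (vel u * sin (lat u) * cos (lon u)) - k * cos (lat u) * sin (lon u)).
    by apply/funext => u; rewrite !mxE.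
  exact: (dB _ _ (dN _ (dM _ _ (dM _ _ dv dsp) dct)) (dM _ _ (dM _ _ dK dcp) dst)).
- have -> : (fun u => torus_velocity n i u ord0 (@Ordinal 3 1 isT)) =
    (fun u => k * cos (lat u) * cos (lon u) - vel u * sin (lat u) * sin (lon u)).
    by apply/funext => u; rewrite !mxE.
  exact: (dB _ _ (dM _ _ (dM _ _ dK dcp) dct) (dM _ _ (dM _ _ dv dsp) dst)).
- have -> : (fun u => torus_velocity n i u ord0 (@Ordinal 3 2 isT)) =
    (fun u => vel u * cos (lat u)).
    by apply/funext => u; rewrite !mxE.
  exact: (dM _ _ dv dcp).
Qed.

Lemma sin0_near (x : R) : sin x = 0 -> - (pi *+ 2) < x < pi *+ 2 ->
  [\/ x = 0, x = pi | x = - pi].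
Proof.
have pos (y : R) : 0 < y < pi *+ 2 -> sin y = 0 -> y = pi.
  move=> /andP[y0 y2] sy; have [y1|y1|//] := ltgtP y pi.
    by have := sin_gt0_pi (introT andP (conj y0 y1)); rewrite sy ltxx.
  have : 0 < sin (y - pi).
    by apply: sin_gt0_pi; apply/andP; split; move: y1 y2; rewrite -?(mulr_natr pi); lra.
  by rewrite -oppr_lt0 -sinDpi subrK sy ltxx.
move=> sx /andP[x1 x2]; have [x0|x0|] := ltgtP x 0; last by constructor 1.
  constructor 3; rewrite -[x]opprK; congr (- _); apply: pos.
    by apply/andP; split; lra.
  by rewrite sinN sx oppr0.
by constructor 2; apply: pos => //; rewrite x0.
Qed.

Lemma cos1_near (x : R) : cos x = 1 -> - (pi *+ 4) < x < pi *+ 4 ->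
  [\/ x = 0, x = pi *+ 2 | x = - (pi *+ 2)].
Proof.
move=> cx /andP[x1 x2].
have sx : sin (x / 2) = 0.
  have : cos ((x / 2) *+ 2) = 1 by rewrite -mulr_natr divfK.
  rewrite cos_mulr2n cos2sin2 => /eqP h; apply/eqP; rewrite -sqrf_eq0; apply/eqP.
  by move/eqP : h; rewrite mulr2n; lra.
have [||h|h] := sin0_near sx.
- by apply/andP; split; move: x1 x2; rewrite -!(mulr_natr pi); lra.
- by move=> h; constructor 1; lra.
- by constructor 2; rewrite -?(mulr_natr pi); lra.
- by constructor 3; rewrite -?(mulr_natr pi); lra.
Qed.

Lemma torus_latitude_bound n i t :
  - (pi / 2) < torus_latitude n i t < pi / 2.
Proof.
have h1 : `|torus_latitude n i t| <= 1.
  by rewrite normrM normrX normrN1 expr1n mul1r sin_max.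
have h2 : 1 < pi / 2 :> R.
  rewrite lt_neqAle pihalf_ge1 andbT; apply/eqP => h.
  by have := @cos1_gt0 R; rewrite h cos_pihalf ltxx.
by rewrite -ltr_norml (le_lt_trans h1).
Qed.

Lemma cos_torus_latitude_gt0 n i t : 0 < cos (torus_latitude n i t).
Proof. exact/cos_gt0_pihalf/torus_latitude_bound. Qed.

Lemma torus_curve_immersion n i t : derive1 (@torus_curve n i) t != 0.
Proof.
rewrite derive1_torus_curve; apply/eqP => /rowP v0.
have c0 := cos_torus_latitude_gt0 n i t.
have vz := v0 (@Ordinal 3 2 isT); rewrite !mxE /= in vz.
have {vz} b0 : torus_latitude_velocity n i t = 0.
  by apply/eqP; move/eqP : vz; rewrite mulf_eq0 (gt_eqF c0) orbF.
have vx := v0 (@Ordinal 3 0 isT); have vy := v0 (@Ordinal 3 1 isT).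
rewrite !mxE /= b0 in vx vy.
have k0 : pi *+ 2 *+ (odd n).+1 * cos (torus_latitude n i t) != 0.
  apply: lt0r_neq0; rewrite pmulr_lgt0 //.
  rewrite pmulrn_lgt0 //; by rewrite pmulrn_lgt0 ?pi_gt0.
have cs0 : cos (torus_longitude n t) = 0.
  by apply: (mulfI k0); rewrite mulr0 -[RHS]vy; ring.
have sn0 : sin (torus_longitude n t) = 0.
  by apply: (mulfI k0); rewrite mulr0 -[RHS]oppr0 -[in RHS]vx; ring.
have := cos2Dsin2 (torus_longitude n t); rewrite cs0 sn0 expr0n /= addr0.
by move/eqP; rewrite eq_sym oner_eq0.
Qed.

Lemma torus_curve_periodic n i : periodic (@torus_curve n i) 1.
Proof.
move=> t; rewrite /torus_curve.
have lonE : torus_longitude n (t + 1) =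
    torus_longitude n t + pi *+ 2 *+ (odd n).+1.
  by rewrite /torus_longitude mulrDr mulr1.
have -> : torus_latitude n i (t + 1) = torus_latitude n i t.
  rewrite /torus_latitude lonE mulrDr; congr (_ * _).
  have -> : n%:R / 2 * (pi *+ 2 *+ (odd n).+1) = pi *+ 2 *+ (n./2 + odd n * n./2 + odd n) :> R.
    have -> : n%:R = (odd n)%:R + 2 * n./2%:R :> R.
      by rewrite -{1}(odd_double_half n) natrD -mul2n natrM.
    rewrite -!(mulr_natr (pi *+ 2)) -(mulr_natr pi) !natrD natrM.
    by case: (odd n) => /=; rewrite ?mul1r ?mul0r -?(natr1 R) /=; field.
  by rewrite (periodicn (@sinD2pi R)).
rewrite lonE; apply/rowP => j; rewrite !mxE.
by rewrite (periodicn (@sinD2pi R)) (periodicn (@cosD2pi R)).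
Qed.

(* Equal points of the curves have the same longitude modulo a turn. *)
Lemma torus_curve_eq n (p q : 'I_(~~ odd n).+1 * R) :
  parameters R (~~ odd n).+1 p -> parameters R (~~ odd n).+1 q -> p <> q ->
  torus_curve p.1 p.2 = torus_curve q.1 q.2 ->
  [/\ sin (n%:R / 2 * torus_longitude n p.2) = 0,
      cos (torus_longitude n p.2) = cos (torus_longitude n q.2),
      sin (torus_longitude n p.2) = sin (torus_longitude n q.2) &
      if odd n then p.2 = q.2 + 2^-1 \/ p.2 = q.2 - 2^-1
      else p.2 = q.2 /\ nat_of_ord p.1 <> nat_of_ord q.1].
Proof.
case: p q => [i s] [j t]; rewrite /parameters /=.
move=> /andP[s0 s1] /andP[t0 t1] neq /rowP E.
have ez := E (@Ordinal 3 2 isT); rewrite !mxE /= in ez.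
have elat : torus_latitude n i s = torus_latitude n j t.
  apply: sin_inj => //; rewrite in_itv /=.
    by have /andP[a b] := torus_latitude_bound n i s; rewrite !ltW.
  by have /andP[a b] := torus_latitude_bound n j t; rewrite !ltW.
have ex := E (@Ordinal 3 0 isT); have ey := E (@Ordinal 3 1 isT).
have c0 : cos (torus_latitude n j t) != 0.
  by rewrite gt_eqF // cos_torus_latitude_gt0.
rewrite !mxE /= elat in ex ey.
have {}ex := mulfI c0 ex; have {}ey := mulfI c0 ey.
have pi0 := pi_gt0 R.
have cd : cos (torus_longitude n s - torus_longitude n t) = 1.
  by rewrite cosB ex ey -!expr2 cos2Dsin2.
have {}cd : s = t \/ (odd n /\ (s = t + 2^-1 \/ s = t - 2^-1)).
  have dE : torus_longitude n s - torus_longitude n t =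
      2 * pi * (1 + odd n)%:R * (s - t).
    by rewrite /torus_longitude -mulrBr -(mulr_natr (pi *+ 2)) -(mulr_natr pi) add1n; ring.
  have := @cos1_near (torus_longitude n s - torus_longitude n t) cd.
  rewrite dE.
  have piI (x y : R) : pi * x = pi * y -> x = y.
    by apply: mulfI; rewrite gt_eqF.
  case: (odd n) => /= h.
    case: h => [|h|h|h]; first by apply/andP; split; nra.
    - by left; apply/eqP; rewrite -subr_eq0; apply/eqP/piI; lra.
    - right; split=> //; left.
      suff : s - t = 2^-1 by lra.
      by apply: piI; move: h; rewrite -?(mulr_natr pi); lra.
    - right; split=> //; right.
      suff : s - t = - 2^-1 by lra.
      by apply: piI; move: h; rewrite -?(mulr_natr pi); lra.
  case: h => [|h|h|h]; first by apply/andP; split; nra.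
  - by left; apply/eqP; rewrite -subr_eq0; apply/eqP/piI; lra.
  - suff : s - t = 1 by lra.
    by apply: piI; move: h; rewrite -?(mulr_natr pi); lra.
  - suff : s - t = - 1 by lra.
    by apply: piI; move: h; rewrite -?(mulr_natr pi); lra.
have shift u v : u = v + 2^-1 -> odd n ->
    torus_longitude n u = torus_longitude n v + pi *+ 2.
  by move=> -> on; rewrite /torus_longitude on mulrDr -(mulr_natr (pi *+ 2)) mulfK.
have sgn (x : R) : x = - x -> x = 0 by lra.
have alt u v : odd n -> u = v + 2^-1 ->
    sin (n%:R / 2 * torus_longitude n u) = sin (n%:R / 2 * torus_longitude n v) ->
    sin (n%:R / 2 * torus_longitude n v) = 0.
  move=> on uv; rewrite (shift _ _ uv on) mulrDr.
  have -> : n%:R / 2 * (pi *+ 2) = pi *+ n :> R.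
    by rewrite -[RHS]mulr_natl mulrnAr -mulrnAl -mulr_natr divfK.
  rewrite (alternatingn (@sinDpi R)) -signr_odd on expr1 mulN1r => /esym.
  exact: sgn.
have li := ltn_ord i; have lj := ltn_ord j.
have odd_ij : odd n -> i = j.
  move=> on; apply: val_inj => /=; move: (nat_of_ord i) (nat_of_ord j) li lj; by rewrite on => -[|?] [|?].
split=> //.
- case: cd => [st|[on st]].
    have ij : val i <> val j.
      by move=> ij; apply: neq; rewrite st (val_inj ij).
    have en : ~~ odd n.
      by apply/negP => on; apply: ij; rewrite (odd_ij on).
    move: elat; rewrite /torus_latitude -st.
    move: ij li lj => /=; move: (nat_of_ord i) (nat_of_ord j) => a b; rewrite en.
    case: a => [|[|//]]; case: b => [|[|//]] // _ _ _; rewrite expr0 expr1 mul1r mulN1r => h; apply: sgn => //; exact: esym.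
  move: elat; rewrite /torus_latitude (odd_ij on).
  have sg0 : (-1) ^+ j != 0 :> R by rewrite signr_eq0.
  move=> /(mulfI sg0) h; case: st => st.
    by rewrite h; exact: (alt s t).
  by apply: (alt t s) => //; rewrite st subrK.
- case: ifP => on.
    case: cd => [st|[_ //]].
    by case: neq; rewrite (odd_ij on) st.
  case: cd => [st|[h]]; last by rewrite h in on.
  by split=> // ij; apply: neq; rewrite (val_inj ij) st.
Qed.

Lemma torus_latitude_velocityN n (i j : nat) u v :
  (i < (~~ odd n).+1)%N -> (j < (~~ odd n).+1)%N ->
  (if odd n then u = v + 2^-1 \/ u = v - 2^-1 else u = v /\ i <> j) ->
  torus_latitude_velocity n j v = - torus_latitude_velocity n i u.
Proof.
rewrite /torus_latitude_velocity; case: ifPn => on /=; rewrite ?ltnS.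
  rewrite !leqn0 => /eqP -> /eqP -> st.
  have alt x y : x = y + 2^-1 ->
      cos (n%:R / 2 * torus_longitude n x) = - cos (n%:R / 2 * torus_longitude n y).
    move=> ->; rewrite {1}/torus_longitude mulrDr -/(torus_longitude n y) on.
    rewrite -(mulr_natr (pi *+ 2)) mulfK // mulrDr.
    have -> : n%:R / 2 * (pi *+ 2) = pi *+ n :> R.
      by rewrite -[RHS]mulr_natl mulrnAr -mulrnAl -mulr_natr divfK.
    by rewrite (alternatingn (@cosDpi R)) -signr_odd on expr1 mulN1r.
  case: st => st; first by rewrite (alt _ _ st) !mulrN opprK.
  by rewrite (alt v u) ?st ?subrK // !mulrN.
move=> ip jq [-> ij].
by case: i ip ij => [|[|//]]; case: j jq => [|[|//]] // _ _ _; rewrite expr0 expr1; ring.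
Qed.

Lemma torus_curve_transverse n (p q : 'I_(~~ odd n).+1 * R) : (0 < n)%N ->
  parameters R (~~ odd n).+1 p -> parameters R (~~ odd n).+1 q -> p <> q ->
  torus_curve p.1 p.2 = torus_curve q.1 q.2 ->
  free [:: derive1 (@torus_curve n p.1) p.2; derive1 (@torus_curve n q.1) q.2].
Proof.
move=> n0 pP qP neq E.
have [sp ec es cases] := torus_curve_eq pP qP neq E.
have [sq _ _ _] := torus_curve_eq qP pP (fun h => neq (esym h)) (esym E).
set k : R := pi *+ 2 *+ (odd n).+1.
have k0 : k != 0.
  apply: lt0r_neq0; rewrite pmulrn_lgt0 //; by rewrite pmulrn_lgt0 ?pi_gt0.
have lat0 m i u : sin (m%:R / 2 * torus_longitude m u) = 0 -> torus_latitude m i u = 0.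
  by rewrite /torus_latitude => ->; rewrite mulr0.
have velE : torus_latitude_velocity n q.1 q.2 = - torus_latitude_velocity n p.1 p.2.
  by apply: torus_latitude_velocityN cases; exact: ltn_ord.
have vel0 : torus_latitude_velocity n p.1 p.2 != 0.
  rewrite /torus_latitude_velocity !mulf_neq0 ?signr_eq0 ?invr_eq0 ?pnatr_eq0 -?lt0n //.
  by rewrite -normr_eq0 sin0cos1 // oner_eq0.
rewrite !derive1_torus_curve; apply/freeP => c.
rewrite !big_ord_recl big_ord0 /= addr0 => /rowP h.
have hx := h (@Ordinal 3 0 isT); have hy := h (@Ordinal 3 1 isT).
have hz := h (@Ordinal 3 2 isT).
rewrite !mxE /= !(lat0 _ _ _ sp) !(lat0 _ _ _ sq) sin0 cos0 velE -/k -?ec -?es in hx hy hz.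
set a := c _ in hx hy hz; set b := c _ in hx hy hz.
have abz : a = b.
  apply: (mulIf vel0); apply/eqP; rewrite -subr_eq0 -[eqbRHS]hz /GRing.scale /=.
  by apply/eqP; ring.
have abxy : a + b = 0.
  have : (a + b) * k * (cos (torus_longitude n p.2) ^+ 2 + sin (torus_longitude n p.2) ^+ 2) = 0.
    pose co := cos (torus_longitude n p.2); pose si := sin (torus_longitude n p.2).
    transitivity (co * 0 - si * 0); last by ring.
    rewrite -[X in co * X]hy -[X in si * X]hx /GRing.scale /= -/co -/si; ring.
  rewrite cos2Dsin2 mulr1 => /eqP; rewrite mulf_eq0 (negPf k0) orbF; exact/eqP.
have a0 : a = 0 by lra.
have b0 : b = 0 by lra.
move=> i; case: (unliftP ord0 i) => [j|] ->; last exact: a0.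
by rewrite (ord1 j).
Qed.

Lemma torus_curve_no_triple n (p q r : 'I_(~~ odd n).+1 * R) :
  parameters R (~~ odd n).+1 p -> parameters R (~~ odd n).+1 q ->
  parameters R (~~ odd n).+1 r -> p <> q -> p <> r -> q <> r ->
  ~ (torus_curve p.1 p.2 = torus_curve q.1 q.2 /\
     torus_curve p.1 p.2 = torus_curve r.1 r.2).
Proof.
move=> pP qP rP pq pr qr [Epq Epr].
have [_ _ _ cpq] := torus_curve_eq pP qP pq Epq.
have [_ _ _ cpr] := torus_curve_eq pP rP pr Epr.
have [_ _ _ cqr] := torus_curve_eq qP rP qr (etrans (esym Epq) Epr).
move: cpq cpr cqr (ltn_ord p.1) (ltn_ord q.1) (ltn_ord r.1).
move: (nat_of_ord p.1) (nat_of_ord q.1) (nat_of_ord r.1) p.2 q.2 r.2.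
move=> a b c u v w; case: ifPn => _ /=.
  by move=> {pP qP rP pq pr qr Epq Epr} [] h1 [] h2 [] h3; lra.
by move=> [_ +] [_ +] [_ +]; case: a b c => [|[|//]] [|[|//]] [|[|//]].
Qed.

Definition torus_projection n (n_gt0 : (0 < n)%N) : link_projection R :=
  @LinkProjection R (~~ odd n).+1 (@torus_curve n) isT
    (fun i t => sphere2_geographic _ _)
    (@torus_curve_periodic n)
    (fun i t => @ex_derive _ _ _ _ _ _ _ (is_derive_torus_curve i t))
    (@continuous_derive1_torus_curve n)
    (@torus_curve_immersion n)
    (fun p q => @torus_curve_transverse n p q n_gt0)
    (@torus_curve_no_triple n).

End TorusProjection.

Arguments torus_projection R {n} n_gt0.

(* Main.v *)
Require Import Defs.
From mathcomp Require Import all_boot all_order all_algebra finmap.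
From mathcomp Require Import all_classical all_reals all_analysis.
From mathcomp Require Import ring lra.

(** Why the recurrence holds.  For n >= 2 the standard projection of T(2,n) has
    n bigons in cyclic order, consecutive ones sharing a crossing, and two
    polygons that have every crossing on their boundary.  An isolated set that
    contains a polygon is therefore a singleton, and the other isolated sets are
    the independent sets of the cycle with n vertices; so
    f_n = c_n + 2x, where c_n is the independence polynomial of that cycle.
    Now c_n counts closed walks of length n on the graph with vertices
    false, true and every edge except the loop at true, a vertex true having
    weight x.  Thus c_n is the trace of the n-th power of a 2 x 2 matrix of trace
    1 and determinant -x, whence c_n = c_(n-1) + x c_(n-2), and what remains
    of f_n - f_(n-1) - x f_(n-2) is 2x - 2x - x (2x) = -2x^2.

    The topological content is that the regions, which are connected components
    of the complement of a curve on the sphere, are the expected ones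
    ([torus_regions]) and meet at the expected crossings
    ([torus_share_crossing]).  In the coordinates longitude and latitude the
    projection is the locus |phi| = h(theta) with h(theta) = |sin(n theta / 2)|.
    It bounds the polygons h < phi and h < - phi, and the bigons |phi| < h, one
    for each interval of longitudes between consecutive zeros of h.  Each face
    is connected because it is a union of coordinate arcs through one point.
    Each closed face is closed in space because it is the image of a compact
    set of coordinates; as finitely many closed faces cover the sphere and
    overlap only on the projection, every face is relatively open and closed in
    the complement, hence is a component ([connected_component_partition]).
    Closedness also gives the boundary: a crossing in the closure of a face lies
    in the closed face, and coordinates then tell which crossings these are. *)

Set Implicit Arguments.
Unset Strict Implicit.
Unset Printing Implicit Defensive.

Import Order.TTheory GRing.Theory Num.Theory.
Import numFieldNormedType.Exports.

Local Open Scope classical_set_scope.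
Local Open Scope ring_scope.

(** * Independent sets and isolated sets of regions *)

Definition independent (I : finType) (adj : rel I) (W : {set I}) :=
  [forall i in W, forall j in W, (i != j) ==> ~~ adj i j].

Lemma independentP (I : finType) (adj : rel I) (W : {set I}) :
  reflect (forall i j, i \in W -> j \in W -> i <> j -> ~ adj i j)
    (independent adj W).
Proof.
apply: (iffP forall_inP) => [H i j iW jW /eqP ij|H i iW].
  by apply/negP; apply: (implyP (forall_inP (H i iW) j jW) ij).
apply/forall_inP => j jW; apply/implyP => /eqP ij; apply/negP.
exact: H.
Qed.

(** Once the regions are listed without repetition and their adjacency is known,
    the generating function is a finite combinatorial sum. *)
Lemma I_generating_finite (R : realType) (L : link_projection R) (I : finType)
    (adj : rel I) (reg : I -> set 'rV[R]_3) :
  injective reg -> regions L = range reg ->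
  (forall i j, share_crossing L (reg i) (reg j) <-> adj i j) ->
  I_generating L = \sum_(W : {set I} | independent adj W) 'X^#|W|.
Proof.
move=> regI regE adjE; pose h (W : {set I}) := [fset reg i | i in W]%fset.
have memh W i : (reg i \in h W) = (i \in W).
  by apply/imfsetP/idP => [[j jW /regI ->]//|iW]; exists i.
rewrite bigfs ?index_enum_uniq //; last by move=> W; rewrite mem_index_enum.
rewrite /I_generating (reindex_fsbig h [set W | independent adj W]).
  apply: eq_fsbigr => W _; congr (_ ^+ _).
  by rewrite card_imfset //= -cardE.
split.
- move=> W /= /independentP iW; split.
    by move=> _ /= /imfsetP[i _ ->]; rewrite regE; exists i.
  move=> _ _ /imfsetP[i /= iV ->] /imfsetP[j /= jV ->] ij.
  by rewrite adjE; apply: iW => // eij; apply: ij; rewrite eij.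
- by move=> V W _ _ hVW; apply/setP => i; rewrite -!memh hVW.
- move=> V [Vreg Viso]; exists [set i | reg i \in V]%SET.
    apply/independentP => i j; rewrite !inE => iV jV ij.
    by rewrite -adjE; apply: Viso => // /regI.
  apply/fsetP => U; apply/idP/idP.
    by case/imfsetP => i /=; rewrite inE => iV ->.
  move=> UV; have := Vreg U UV; rewrite regE => -[i _ iU].
  by rewrite -iU memh inE iU.
Qed.

(** * Weighted walks and cycles *)

Definition not_both (a b : bool) := ~~ (a && b).

(** The walks from a to b with m intermediate vertices, no two consecutive
    vertices being both true; only intermediate vertices are weighted. *)
Definition walk_poly m (a b : bool) : {poly int} :=
  \sum_(t : m.-tuple bool | path not_both a (rcons t b)) 'X^(count id t).

Lemma walk_polyS m a b :
  walk_poly m.+1 a b = \sum_(c | not_both a c) 'X^c * walk_poly m c b.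
Proof.
rewrite /walk_poly; under [RHS]eq_bigr do rewrite mulr_sumr.
rewrite pair_big_dep /=.
rewrite (reindex (fun p : bool * m.-tuple bool => cons_tuple p.1 p.2)) /=.
  by apply: eq_bigr => p _; rewrite exprD.
exists (fun t => (thead t, behead_tuple t)) => [[c t] _|t _].
  by congr pair; exact: val_inj.
by apply: val_inj; case/tupleP: t.
Qed.

(** The Cayley-Hamilton relation of the transfer matrix
    [[1, x], [1, 0]], entry by entry. *)
Lemma walk_polySS m a b :
  walk_poly m.+2 a b = walk_poly m.+1 a b + 'X * walk_poly m a b.
Proof.
have F k : walk_poly k.+1 false b = walk_poly k false b + 'X * walk_poly k true b.
  by rewrite walk_polyS big_bool /= expr0 expr1 mul1r addrC.
have T k : walk_poly k.+1 true b = walk_poly k false b.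
  by rewrite walk_polyS big_mkcond big_bool /= expr0 mul1r add0r.
by case: a; rewrite ?T F ?T.
Qed.

Lemma cycle_tupleP m (e : rel bool) (t : m.+1.-tuple bool) :
  cycle e t = [forall i, e (tnth t i) (tnth t (ordS i))].
Proof.
have -> : cycle e t = path e (thead t) (rcons (behead t) (thead t)).
  by case/tupleP: t => x s; rewrite theadE.
have tE : val t = thead t :: behead t by case/tupleP: t => x s.
have szt : size (behead t) = m by rewrite size_behead size_tuple.
have nthE (i : 'I_m.+1) :
    nth (thead t) (thead t :: rcons (behead t) (thead t)) i = tnth t i.
  by rewrite -rcons_cons -tE nth_rcons size_tuple ltn_ord (tnth_nth (thead t)).
have nthSE (i : 'I_m.+1) :
    nth (thead t) (rcons (behead t) (thead t)) i = tnth t (ordS i).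
  rewrite nth_rcons szt (tnth_nth (thead t)) /=; have := ltn_ord i.
  rewrite ltnS leq_eqVlt => /orP[/eqP ->|im].
    by rewrite ltnn eqxx modnn; move: tE => /= ->.
  by rewrite im modn_small //; move: tE => /= ->.
apply/(pathP (thead t))/forallP => H i.
  by rewrite -nthE -nthSE; apply: H; rewrite size_rcons szt.
rewrite size_rcons szt => lti.
by have := H (Ordinal lti); rewrite -nthE -nthSE.
Qed.

Definition cyclic_independent n (C : {set 'I_n}) :=
  [forall i, not_both (i \in C) (ordS i \in C)].

(** A set of vertices of a cycle is read as a closed walk, cut open at the
    vertex 0; this is the trace of a power of the transfer matrix. *)
Lemma cyclic_independent_poly m :
  \sum_(C : {set 'I_m.+1} | cyclic_independent C) 'X^#|C| =
  \sum_(a : bool) 'X^a * walk_poly m a a :> {poly int}.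
Proof.
rewrite /walk_poly; under [RHS]eq_bigr do rewrite mulr_sumr.
rewrite pair_big_dep /=.
have -> : \sum_(C : {set 'I_m.+1} | cyclic_independent C) 'X^#|C| =
    \sum_(t : m.+1.-tuple bool | cycle not_both t) 'X^(count id t) :> {poly int}.
  pose h (t : m.+1.-tuple bool) := [set i | tnth t i]%SET.
  rewrite (reindex h) /=; last first.
    exists (fun C : {set 'I_m.+1} => [tuple i \in C | i < m.+1]) => [t _|C _].
      by apply: eq_from_tnth => i; rewrite tnth_mktuple inE.
    by apply/setP => i; rewrite inE tnth_mktuple.
  apply: eq_big => t.
    by rewrite cycle_tupleP; apply: eq_forallb => i; rewrite !inE.
  move=> _; congr (_ ^+ _).
  rewrite cardsE -[in RHS](map_tnth_enum t) count_map -size_filter cardE enumT /=.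
  by rewrite /enum_mem; congr size; apply: eq_filter => i.
rewrite (reindex (fun p : bool * m.-tuple bool => cons_tuple p.1 p.2)) /=.
  by apply: eq_bigr => p _; rewrite exprD.
exists (fun t => (thead t, behead_tuple t)) => [[c t] _|t _].
  by congr pair; exact: val_inj.
by apply: val_inj; case/tupleP: t.
Qed.

(** * The combinatorial regions of T(2,n) *)

(** Regions are indexed by 'I_n + bool: [inl i] is the bigon between the
    crossings i and i + 1 modulo n, [inr false] and [inr true] are the northern
    and the southern polygon. *)
Definition corner n (j : 'I_n + bool) (k : 'I_n) : bool :=
  if j is inl i then (k == i) || (k == ordS i) else true.

Definition share_corner n : rel ('I_n + bool) :=
  fun i j => [exists k, corner i k && corner j k].

Lemma ordS_neq n (i : 'I_n) : (1 < n)%N -> (ordS i == i) = false.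
Proof.
case: n i => // n i n1; apply/eqP => /(congr1 val) /=; have := ltn_ord i.
rewrite ltnS leq_eqVlt => /orP[/eqP ->|im].
  by rewrite modnn => n0; rewrite -n0 in n1.
by rewrite modn_small // => /eqP; rewrite eqn_leq ltnn.
Qed.

Lemma independent_polygon n (W : {set 'I_n + bool}) (b : bool) : (0 < n)%N ->
  inr b \in W -> independent (@share_corner n) W = (W == [set inr b]%SET).
Proof.
move=> n0 bW; apply/independentP/eqP => [H|-> i j].
  apply/eqP; rewrite finset.eqEsubset finset.sub1set bW andbT.
  apply/fintype.subsetP => j jW; rewrite inE; apply/eqP; apply: contrapT => jb.
  apply: (H j (inr b) jW bW jb); apply/existsP.
  exists (if j is inl i then i else Ordinal n0).
  by case: j {jW jb} => //= i; rewrite eqxx.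
by rewrite !inE => /eqP -> /eqP ->.
Qed.

(** For n = 2 the two bigons share both crossings, which agrees with the cycle
    of length 2; for n = 1 the statement fails, as a vertex of the cycle would
    then be adjacent to itself. *)
Lemma independent_bigons n (C : {set 'I_n}) : (1 < n)%N ->
  independent (@share_corner n) (inl @: C)%SET = cyclic_independent C.
Proof.
move=> n1; apply/independentP/forallP =>
    [H i|H _ _ /imsetP[i iC ->] /imsetP[j jC ->] ij].
  apply/negP => /andP[iC sC].
  apply: (H (inl i) (inl (ordS i))); rewrite ?imset_f //.
    by case=> /esym/eqP; rewrite ordS_neq.
  by apply/existsP; exists (ordS i); rewrite /= !eqxx orbT.
case/existsP => k /andP[/orP[] /eqP -> /orP[] /eqP kj].
- by apply: ij; rewrite kj.
- by have := H j; rewrite /not_both jC -kj iC.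
- by have := H i; rewrite /not_both iC kj jC.
- by apply: ij; rewrite (ordS_inj kj).
Qed.

Lemma independent_poly n : (1 < n)%N ->
  \sum_(W : {set 'I_n + bool} | independent (@share_corner n) W) 'X^#|W| =
  \sum_(C : {set 'I_n} | cyclic_independent C) 'X^#|C| + 'X *+ 2 :> {poly int}.
Proof.
move=> n1; have n0 := ltnW n1.
rewrite (bigID (fun W : {set 'I_n + bool} => [exists b, inr b \in W])) /= addrC.
congr (_ + _).
  pose h (C : {set 'I_n}) : {set 'I_n + bool} := (inl @: C)%SET.
  rewrite (reindex_onto h (fun W => [set i | inl i \in W]%SET)) /=; last first.
    move=> W /andP[_ /existsPn nb]; apply/setP => -[i|b].
      by rewrite mem_imset ?inE //; exact: inl_inj.
    by rewrite (negPf (nb b)); apply/imsetP => -[].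
  apply: eq_big => [C|C _]; last by rewrite card_imset //; exact: inl_inj.
  rewrite independent_bigons //.
  have -> : [set i | inl i \in h C]%SET = C.
    by apply/setP => i; rewrite inE mem_imset //; exact: inl_inj.
  rewrite eqxx andbT; have -> : [exists b, inr b \in h C] = false.
    by apply/existsP => -[b /imsetP[]].
  by rewrite andbT.
pose s (b : bool) : {set 'I_n + bool} := [set inr b]%SET.
have sI : injective s by move=> b c /set1_inj[].
rewrite (eq_bigl (fun W => W \in [set s b | b : bool]%SET)); last first.
  move=> W; apply/andP/imsetP => [[iW /existsP[b bW]]|[b _ ->]].
    by exists b => //; apply/eqP; rewrite -(independent_polygon n0 bW).
  have bs : inr b \in s b by rewrite inE.
  rewrite (independent_polygon n0 bs) eqxx; split=> //.
  by apply/existsP; exists b.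
rewrite big_imset /=; last by move=> *; exact: sI.
by rewrite big_bool /= !cards1 expr1 mulr2n.
Qed.

(** * Connectedness, closedness and closures *)

(** If finitely many closed sets cover Y and are disjoint inside Y, then their
    traces on Y are relatively closed, and relatively open as complements of
    one another; a connected trace is then a whole component. *)
Lemma connected_component_partition (T : topologicalType) (I : finType)
    (Y : set T) (F : I -> set T) (i : I) (x : T) :
  (forall i, closed (F i)) -> (forall i, connected (Y `&` F i)) ->
  Y `<=` \bigcup_i F i ->
  (forall i j y, Y y -> F i y -> F j y -> i = j) ->
  Y x -> F i x -> connected_component Y x = Y `&` F i.
Proof.
move=> cF cYF cov inj Yx Fx; apply/seteqP; split; last first.
  by apply: connected_component_max => // y [].
have CY := @connected_component_sub _ Y x.
have xC : connected_component Y x x by exact: connected_component_refl.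
have : connected_component Y x `&` F i = connected_component Y x.
  apply: (@component_connected _ Y x).
  - by exists x.
  - exists (~` \bigcup_(j in [set j | j != i]) F j).
      by apply: closed_openC; apply: closed_bigcup => //; exact: finite_finset.
    apply/seteqP; split=> y [Cy Fy]; split=> //.
      move=> -[j /= /eqP ji Fj]; apply: ji; exact: (inj _ _ y (CY _ Cy)).
    have [j _ Fj] := cov _ (CY _ Cy); have [<-//|ji] := eqVneq j i.
    by case: Fy; exists j.
  - by exists (F i).
by move=> <- y [Cy Fy]; split=> //; exact: CY.
Qed.

Lemma connected_star (T : topologicalType) (A : set T) (c : T) :
  (forall x, A x -> exists B, [/\ connected B, B `<=` A, B c & B x]) ->
  connected A.
Proof.
move=> star; pose P := [set B : set T | [/\ connected B, B `<=` A & B c]].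
have -> : A = \bigcup_(B in P) B.
  apply/seteqP; split=> [x /star[B [cB BA Bc Bx]]|x [B [_ BA _] /BA//]].
  by exists B.
by apply: bigcup_connected => [|B []//]; exists c => B [].
Qed.

Lemma connected_path (R : realType) (T : topologicalType) (f : R -> T)
    (A : set T) (J : set R) s t :
  continuous f -> is_interval J -> J s -> J t -> f @` J `<=` A ->
  exists B, [/\ connected B, B `<=` A, B (f s) & B (f t)].
Proof.
move=> cf iJ Js Jt JA; exists (f @` J); split=> //.
apply: connected_continuous_connected; first exact/connected_intervalP.
exact: continuous_subspaceT.
Qed.

Lemma closed_le_continuous (R : realType) (T : topologicalType) (f g : T -> R) :
  continuous f -> continuous g -> closed [set x | f x <= g x].
Proof.
move=> cf cg.
have -> : [set x | f x <= g x] = (fun x => g x - f x) @^-1` [set y | 0 <= y].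
  by apply/seteqP; split=> x /=; rewrite subr_ge0.
apply: preimage_closed; last exact: closed_ge.
by move=> x _; apply: cvgB; [exact: cg|exact: cf].
Qed.

Lemma continuous_mx (T U : topologicalType) m n (f : T -> 'M[U]_(m, n)) :
  (forall i j, continuous (fun x => f x i j)) -> continuous f.
Proof.
move=> cf x A [P fP PA]; apply: (filterS PA); apply: filter_forall => i.
apply: filter_forall => j; exact: (cf i j x _ (fP i j)).
Qed.

Lemma closure_continuous_image (T U : topologicalType) (f : T -> U)
    (A : set T) x :
  continuous f -> closure A x -> closure (f @` A) (f x).
Proof.
by move=> cf Ax B /cf /Ax [y [Ay By]]; exists (f y); split=> //; exists y.
Qed.

Lemma closure_itvoo (R : realType) (a b : R) : a < b ->
  closure `]a, b[ a /\ closure `]a, b[ b.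
Proof.
move=> ab; split=> B xB.
- have aB : \forall x \near a^'+, B x by apply: cvg_within; exact: xB.
  near a^'+ => x; exists x; split; last by near: x.
  by rewrite /= in_itv /=; apply/andP; split; near: x;
    [exact: nbhs_right_gt|exact: nbhs_right_lt].
- have bB : \forall x \near b^'-, B x by apply: cvg_within; exact: xB.
  near b^'- => x; exists x; split; last by near: x.
  by rewrite /= in_itv /=; apply/andP; split; near: x;
    [exact: nbhs_left_gt|exact: nbhs_left_lt].
Unshelve. all: by end_near. Qed.

(** * Longitude and latitude on the sphere *)

Section Sphere.
Variable R : realType.
Implicit Types theta phi : R.

Lemma continuous_geographic :
  continuous (fun p : R * R => geographic p.1 p.2).
Proof.
apply: continuous_mx => i j; rewrite (ord1 i) => {i}.
have c1 (g : R -> R) : continuous g -> continuous (fun p : R * R => g p.1).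
  by move=> cg p; apply: continuous_comp; [exact: cvg_fst|exact: cg].
have c2 (g : R -> R) : continuous g -> continuous (fun p : R * R => g p.2).
  by move=> cg p; apply: continuous_comp; [exact: cvg_snd|exact: cg].
elim/ord3_ind: j; under [fun _ => _]eq_fun do rewrite mxE /=.
- by move=> p; apply: cvgM;
    [apply: c2; exact: continuous_cos|apply: c1; exact: continuous_cos].
- by move=> p; apply: cvgM;
    [apply: c2; exact: continuous_cos|apply: c1; exact: continuous_sin].
- exact: c2 (@continuous_sin R).
Qed.

Lemma continuous_geographic_comp (f g : R -> R) :
  continuous f -> continuous g -> continuous (fun t => geographic (f t) (g t)).
Proof.
move=> cf cg t; apply: (@continuous_comp _ _ _ (fun t => (f t, g t))
  (fun p => geographic p.1 p.2)); last exact: continuous_geographic.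
exact: cvg_pair (cf t) (cg t).
Qed.

Lemma continuous_parallel phi : continuous (fun theta => geographic theta phi).
Proof.
by apply: continuous_geographic_comp => t; [exact: cvg_id|exact: cvg_cst].
Qed.

Lemma continuous_meridian theta c :
  continuous (fun phi => geographic theta (c * phi)).
Proof.
apply: continuous_geographic_comp => t; first exact: cvg_cst.
by apply: cvgM; [exact: cvg_cst|exact: cvg_id].
Qed.

(** Coordinates are unique up to full turns of the longitude, except at the
    poles, where the longitude is arbitrary. *)
Lemma geographic_eq theta phi theta' phi' :
  `|phi| <= pi / 2 -> `|phi'| <= pi / 2 ->
  geographic theta phi = geographic theta' phi' ->
  phi = phi' /\
  (`|phi| < pi / 2 -> cos theta = cos theta' /\ sin theta = sin theta').
Proof.
move=> b b' /rowP E.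
have ez := E (@Ordinal 3 2 isT); rewrite !mxE /= in ez.
have {ez} ephi : phi = phi' by apply: sin_inj; rewrite // in_itv /= -ler_norml.
split=> // lt.
have ex := E (@Ordinal 3 0 isT); have ey := E (@Ordinal 3 1 isT).
rewrite !mxE /= -ephi in ex ey.
have c0 : cos phi != 0 by rewrite gt_eqF // cos_gt0_pihalf // -ltr_norml.
by split; apply: (mulfI c0).
Qed.

Lemma geographic_pole theta theta' phi : cos phi = 0 ->
  geographic theta phi = geographic theta' phi.
Proof. by move=> c0; apply/rowP; elim/ord3_ind; rewrite !mxE /= ?c0 ?mul0r. Qed.

Lemma geographic_turn theta phi :
  geographic (theta + pi *+ 2) phi = geographic theta phi.
Proof. by apply/rowP => j; rewrite !mxE sinD2pi cosD2pi. Qed.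

Lemma sqr_le1_itv (x : R) : x ^+ 2 <= 1 -> -1 <= x <= 1.
Proof.
by move=> x1; rewrite -ler_norml -(@expr_le1 _ 2) // real_normK ?num_real.
Qed.

Lemma unit_circle_param (x y : R) : x ^+ 2 + y ^+ 2 = 1 ->
  exists2 t : R, 0 <= t < pi *+ 2 & x = cos t /\ y = sin t.
Proof.
move=> xy; have x1 : -1 <= x <= 1.
  by apply: sqr_le1_itv; rewrite -xy lerDl sqr_ge0.
have ca : cos (acos x) = x by rewrite acosK // in_itv.
have sa : sin (acos x) = `|y|.
  by rewrite sin_acos // -sqrtr_sqr; congr Num.sqrt; rewrite -xy; ring.
have a0 := acos_ge0 x1; have a1 := acos_lepi x1; have pi0 := pi_gt0 R.
have [y0|y0] := leP 0 y.
  exists (acos x); last by rewrite ca sa ger0_norm.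
  by rewrite a0 -(mulr_natr pi); lra.
exists (pi *+ 2 - acos x).
  rewrite -(mulr_natr pi); have [a00|] := eqVneq (acos x) 0.
    by move: sa; rewrite a00 sin0 => /esym/normr0_eq0 y00; rewrite y00 ltxx in y0.
  move=> an0; have {an0} : 0 < acos x by rewrite lt0r an0.
  by move=> ?; apply/andP; split; lra.
have -> : pi *+ 2 - acos x = - acos x + pi *+ 2 by rewrite addrC.
by rewrite cosD2pi sinD2pi cosN sinN ca sa ltr0_norm ?opprK.
Qed.

Lemma geographic_onto (p : 'rV[R]_3) : sphere2 p ->
  exists theta phi, [/\ 0 <= theta < pi *+ 2, `|phi| <= pi / 2 &
    p = geographic theta phi].
Proof.
rewrite /sphere2 /= !big_ord_recl big_ord0 addr0 /=.
have -> : lift ord0 ord0 = @Ordinal 3 1 isT by exact: val_inj.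
have -> : lift ord0 (lift ord0 ord0) = @Ordinal 3 2 isT by exact: val_inj.
set x := p ord0 ord0; set y := p ord0 (Ordinal _); set z := p ord0 (Ordinal _).
move=> xyz; have z1 : -1 <= z <= 1.
  by apply: sqr_le1_itv; rewrite -xyz addrA lerDr addr_ge0 ?sqr_ge0.
have phiB : `|asin z| <= pi / 2 by rewrite ler_norml asin_geNpi2 ?asin_lepi2.
have sphi : sin (asin z) = z by rewrite asinK // in_itv.
pose c := cos (asin z).
have c2 : c ^+ 2 = x ^+ 2 + y ^+ 2.
  by have := cos2Dsin2 (asin z); rewrite sphi -/c; lra.
have [t tB [xt yt]] :
    exists2 t : R, 0 <= t < pi *+ 2 & x = c * cos t /\ y = c * sin t.
  have [c0|c0] := eqVneq c 0.
    exists 0; first by rewrite lexx pmulrn_lgt0 ?pi_gt0.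
    rewrite c0 !mul0r; move: c2; rewrite c0 expr0n /= => /esym/eqP.
    by rewrite paddr_eq0 ?sqr_ge0 // !sqrf_eq0 => /andP[/eqP ? /eqP ?].
  have [|t tB [xt yt]] := @unit_circle_param (x / c) (y / c).
    by rewrite !exprMn -mulrDl -c2 exprVn divff // sqrf_eq0.
  by exists t => //; rewrite -xt -yt !mulrA ![c * _]mulrC !mulfK.
exists t, (asin z); split=> //; apply/rowP; elim/ord3_ind; rewrite !mxE /=.
- by rewrite -/c -xt; congr (p _ _); exact: val_inj.
- by rewrite -/c -yt.
- by rewrite sphi.
Qed.

Lemma longitude_eq theta theta' :
  0 <= theta <= pi *+ 2 -> 0 <= theta' <= pi *+ 2 ->
  cos theta = cos theta' -> sin theta = sin theta' ->
  [\/ theta = theta', theta = 0 /\ theta' = pi *+ 2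
    | theta = pi *+ 2 /\ theta' = 0].
Proof.
have pi0 := pi_gt0 R.
move=> /andP[t0 t1] /andP[t0' t1'] ec es.
have : cos (theta - theta') = 1 by rewrite cosB ec es -!expr2 cos2Dsin2.
move: t1 t1'; rewrite -!(mulr_natr pi) => t1 t1'.
case/cos1_near => [|h|h|h].
- by rewrite -!(mulr_natr pi); apply/andP; split; lra.
- by constructor 1; lra.
- by constructor 3; move: h; rewrite -!(mulr_natr pi); split; lra.
- by constructor 2; move: h; rewrite -!(mulr_natr pi); split; lra.
Qed.

End Sphere.

(** * The strands of the torus projection *)

Section Torus.
Variable R : realType.
Implicit Types (n : nat) (theta phi : R).
Local Notation globe := (fun p : R * R => geographic p.1 p.2).
Local Notation complement n_gt0 :=
  (@sphere2 R `\` shadow (torus_projection R n_gt0)).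

Definition phase n theta : R := n%:R / 2 * theta.

(** At longitude theta the two strands have latitudes plus and minus this. *)
Definition strand_height n theta : R := `|sin (phase n theta)|.

Lemma strand_height_ge0 n theta : 0 <= strand_height n theta.
Proof. exact: normr_ge0. Qed.

Lemma strand_height_lt n theta : strand_height n theta < pi / 2.
Proof.
have := torus_latitude_bound n 0 (theta / (pi *+ 2 *+ (odd n).+1)).
rewrite /torus_latitude /torus_longitude expr0 mul1r -ltr_norml.
rewrite [_ * (theta / _)]mulrC divfK //.
by rewrite gt_eqF // pmulrn_lgt0 // pmulrn_lgt0 // pi_gt0.
Qed.

(** The height is a function on the sphere minus its poles, although the phase
    is not a function of the point: its square is (1 - cos (n theta)) / 2. *)
Lemma strand_height_congr n theta theta' :
  cos theta = cos theta' -> sin theta = sin theta' ->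
  strand_height n theta = strand_height n theta'.
Proof.
move=> ec es.
have [cn _] : cos (theta *+ n) = cos (theta' *+ n) /\
    sin (theta *+ n) = sin (theta' *+ n).
  elim: n => [|n [IHc IHs]]; first by rewrite !mulr0n.
  by rewrite !mulrSr !cosD !sinD IHc IHs ec es.
suff sq t : sin (phase n t) ^+ 2 = (1 - cos (t *+ n)) / 2.
  by rewrite /strand_height -!sqrtr_sqr !sq cn.
have -> : t *+ n = phase n t *+ 2.
  by rewrite /phase -[LHS]mulr_natl -[RHS]mulr_natr; field.
by rewrite cos_mulr2n -[X in _ = (1 - X) / _]/(_ *+ 2 - 1) cos2sin2 -mulr_natr;
  field.
Qed.

Lemma strand_height_eq0 n k theta :
  phase n theta = k%:R * pi -> strand_height n theta = 0.
Proof.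
move=> kE; rewrite /strand_height kE mulr_natl -[pi *+ k]add0r.
by rewrite (alternatingn (@sinDpi R)) sin0 mulr0 normr0.
Qed.

Lemma strand_height_gt0 n k theta :
  k%:R * pi < phase n theta < k.+1%:R * pi -> 0 < strand_height n theta.
Proof.
move=> /andP[k1 k2]; rewrite /strand_height.
rewrite -[phase n theta](subrK (pi *+ k)) (alternatingn (@sinDpi R)).
rewrite normrM normrX normrN1 expr1n mul1r normr_gt0 gt_eqF // sin_gt0_pi //.
by move: k1 k2; rewrite -(natr1 k) -(mulr_natl pi); lra.
Qed.

Lemma phase_turn n theta : phase n (theta + pi *+ 2) = phase n theta + pi *+ n.
Proof. by rewrite /phase -[pi *+ n]mulr_natl -(mulr_natr pi); field. Qed.

(** The longitude of the k-th crossing. *)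
Definition tick n (k : nat) : R := k%:R * (pi *+ 2) / n%:R.

Lemma phase_tick n k : (0 < n)%N -> phase n (tick n k) = k%:R * pi.
Proof.
move=> n0; rewrite /phase /tick -(mulr_natr pi); field.
by rewrite pnatr_eq0 -lt0n.
Qed.

Lemma phase_le n theta theta' : (0 < n)%N ->
  (phase n theta <= phase n theta') = (theta <= theta').
Proof. by move=> n0; rewrite ler_pM2l // divr_gt0 ?ltr0n. Qed.

Lemma phase_lt n theta theta' : (0 < n)%N ->
  (phase n theta < phase n theta') = (theta < theta').
Proof. by move=> n0; rewrite ltr_pM2l // divr_gt0 ?ltr0n. Qed.

Lemma tickn n : (0 < n)%N -> tick n n = pi *+ 2.
Proof.
by move=> n0; rewrite /tick mulrAC divff ?mul1r // pnatr_eq0 -lt0n.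
Qed.

Lemma tick0 n : tick n 0 = 0.
Proof. by rewrite /tick mul0r mul0r. Qed.

Lemma tick_le n k l : (0 < n)%N -> (tick n k <= tick n l) = (k <= l)%N.
Proof.
move=> n0; rewrite -(phase_le _ _ n0) !phase_tick //.
by rewrite ler_pM2r ?pi_gt0 // ler_nat.
Qed.

Lemma tick_lt n k l : (0 < n)%N -> (tick n k < tick n l) = (k < l)%N.
Proof. by move=> n0; rewrite ltNge tick_le // -ltnNge. Qed.

Lemma tick_turn n (k : 'I_n) : 0 <= tick n k <= pi *+ 2.
Proof.
have n0 : (0 < n)%N by apply: leq_ltn_trans (ltn_ord k).
by rewrite -{1}(tick0 n) -(tickn n0) !tick_le //= ltnW.
Qed.

Lemma strand_height_tick n k : (0 < n)%N -> strand_height n (tick n k) = 0.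
Proof. by move=> n0; rewrite (@strand_height_eq0 n k) // phase_tick. Qed.

Lemma strand_height_between_ticks n k theta : (0 < n)%N ->
  tick n k < theta < tick n k.+1 -> 0 < strand_height n theta.
Proof.
move=> n0 kt; rewrite (@strand_height_gt0 n k) //.
by rewrite -!(phase_tick _ n0) !phase_lt.
Qed.

Lemma mid_tick n k : (0 < n)%N ->
  tick n k < (tick n k + tick n k.+1) / 2 < tick n k.+1.
Proof.
move=> n0; have := tick_lt k k.+1 n0; rewrite ltnSn => h.
by apply/andP; split; lra.
Qed.

Lemma tick_floor n theta : (0 < n)%N -> 0 <= theta < pi *+ 2 ->
  exists2 k, (k < n)%N & tick n k <= theta < tick n k.+1.
Proof.
move=> n0 /andP[t0 t2]; have p0 : 0 <= phase n theta / pi.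
  by rewrite divr_ge0 ?pi_ge0 // mulr_ge0 // divr_ge0.
have /andP[k1 k2] := truncn_itv p0; set k := Num.trunc _ in k1 k2.
have kt : tick n k <= theta < tick n k.+1.
  rewrite -(phase_le _ _ n0) -(phase_lt _ _ n0) !phase_tick //.
  by rewrite -ler_pdivlMr ?pi_gt0 // -ltr_pdivrMr ?pi_gt0 // k1.
exists k => //; rewrite -(tick_lt _ _ n0) tickn //.
by case/andP: kt => kt _; exact: le_lt_trans t2.
Qed.

(** The strand at latitude - sin (n theta / 2) is the second component if n is
    even, and the second turn of the only component if n is odd. *)
Lemma torus_shadow n (n0 : (0 < n)%N) :
  shadow (torus_projection R n0) =
  [set x | exists theta phi,
     `|phi| = strand_height n theta /\ x = geographic theta phi].
Proof.
have K0 : pi *+ 2 *+ (odd n).+1 != 0 :> R.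
  by rewrite gt_eqF // pmulrn_lgt0 // pmulrn_lgt0 // pi_gt0.
apply/seteqP; split=> x.
  move=> [i [t _ <-]]; exists (torus_longitude n t), (torus_latitude n i t).
  by rewrite /torus_latitude normrM normrX normrN1 expr1n mul1r.
have lonE theta : torus_longitude n (theta / (pi *+ 2 *+ (odd n).+1)) = theta.
  by rewrite /torus_longitude mulrC divfK.
move=> [theta [phi [phiE ->]]].
have [i0 i0E] : exists i : 'I_(~~ odd n).+1, nat_of_ord i = 0%N by exists ord0.
have first_strand t : phi = sin (phase n t) ->
    shadow (torus_projection R n0) (geographic t phi).
  move=> E; exists i0, (t / (pi *+ 2 *+ (odd n).+1)) => //=.
  by rewrite /torus_curve /torus_latitude lonE i0E expr0 mul1r -/(phase n t) -E.
have [E|E] : phi = sin (phase n theta) \/ phi = - sin (phase n theta).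
  by move/eqP: phiE; rewrite eqr_norm2 => /orP[] /eqP; [left|right].
  exact: first_strand.
have [on|en] := boolP (odd n).
  rewrite -geographic_turn; apply: first_strand.
  by rewrite phase_turn (alternatingn (@sinDpi R)) -signr_odd on expr1 mulN1r.
have [i1 i1E] : exists i : 'I_(~~ odd n).+1, nat_of_ord i = 1%N.
  by rewrite en; exists (@Ordinal 2 1 isT).
exists i1, (theta / (pi *+ 2 *+ (odd n).+1)) => //=.
rewrite /torus_curve /torus_latitude lonE i1E expr1 mulN1r.
by rewrite -/(phase n theta) -E.
Qed.

Lemma geographic_shadow n (n0 : (0 < n)%N) theta phi : `|phi| <= pi / 2 ->
  shadow (torus_projection R n0) (geographic theta phi) <->
  `|phi| = strand_height n theta.
Proof.
move=> phiB; rewrite torus_shadow; split=> [|E]; last by exists theta, phi.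
move=> [theta' [phi' [E Exy]]].
have phiB' : `|phi'| <= pi / 2 by rewrite E ltW // strand_height_lt.
have [e H] := geographic_eq phiB phiB' Exy.
have [ec es] : cos theta = cos theta' /\ sin theta = sin theta'.
  by apply: H; rewrite e E strand_height_lt.
by rewrite e E (strand_height_congr n ec es).
Qed.

(** * The faces and their closures *)

Definition closed_cell n (j : 'I_n + bool) : set (R * R) :=
  match j with
  | inl k => [set p | tick n k <= p.1 <= tick n k.+1 /\
                      `|p.2| <= strand_height n p.1]
  | inr b => [set p | 0 <= p.1 <= pi *+ 2 /\
                      strand_height n p.1 <= (-1) ^+ b * p.2 <= pi / 2]
  end.

(** Strict only where the boundary is part of the projection: the cell of a
    polygon keeps the pole and both ends of the full turn of longitudes. *)
Definition open_cell n (j : 'I_n + bool) : set (R * R) :=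
  match j with
  | inl k => [set p | tick n k < p.1 < tick n k.+1 /\
                      `|p.2| < strand_height n p.1]
  | inr b => [set p | 0 <= p.1 <= pi *+ 2 /\
                      strand_height n p.1 < (-1) ^+ b * p.2 <= pi / 2]
  end.

Definition closed_face n (j : 'I_n + bool) : set 'rV[R]_3 :=
  globe @` closed_cell j.

Definition face n (n0 : (0 < n)%N) (j : 'I_n + bool) : set 'rV[R]_3 :=
  complement n0 `&` closed_face j.

Lemma open_closed_cell n (j : 'I_n + bool) : open_cell j `<=` closed_cell j.
Proof.
case: j => [k|b] p [].
  by move=> /andP[/ltW k1 /ltW k2] /ltW h; split=> //; rewrite k1.
by move=> p1 /andP[/ltW h1 h2]; split=> //; rewrite h1.
Qed.

Lemma closed_cell_box n (j : 'I_n + bool) (p : R * R) : (0 < n)%N ->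
  closed_cell j p -> 0 <= p.1 <= pi *+ 2 /\ `|p.2| <= pi / 2.
Proof.
move=> n0; case: j => [k [/andP[k1 k2] h]|b [p1 /andP[h1 h2]]].
  split; last by rewrite (le_trans h) // ltW // strand_height_lt.
  rewrite -(tick0 n) -(tickn n0) (le_trans _ k1) ?tick_le //.
  by rewrite (le_trans k2) ?tick_le.
split=> //.
have -> : `|p.2| = `|(-1) ^+ b * p.2|.
  by rewrite normrM normrX normrN1 expr1n mul1r.
by rewrite ger0_norm // (le_trans _ h1) // strand_height_ge0.
Qed.

Lemma open_cell_side n (j : 'I_n + bool) (p : R * R) : open_cell j p ->
  match j with
  | inl _ => is_true (`|p.2| < strand_height n p.1)
  | inr b => strand_height n p.1 < `|p.2| /\ (p.2 < 0) = b
  end.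
Proof.
case: j => [k|b] [_] // /andP[h1 _].
have h0 := le_lt_trans (strand_height_ge0 n p.1) h1.
case: b h0 h1; rewrite ?expr0 ?expr1 ?mul1r ?mulN1r => h0 h1.
  by rewrite ltr0_norm -oppr_gt0.
by rewrite gtr0_norm //; split=> //; rewrite ltNge ltW.
Qed.

Lemma open_cell_off n (j : 'I_n + bool) (p : R * R) :
  open_cell j p -> `|p.2| <> strand_height n p.1.
Proof.
move=> /open_cell_side; case: j => [k|b]; first by move=> + E; rewrite E ltxx.
by move=> -[+ _] E; rewrite E ltxx.
Qed.

Lemma open_cell_equator n (k : 'I_n) t : (0 < n)%N ->
  tick n k < t < tick n k.+1 -> open_cell (inl k) (t, 0).
Proof.
move=> n0 kt; split=> //=.
by rewrite normr0; exact: strand_height_between_ticks kt.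
Qed.

Lemma open_cell_meridian n b theta phi : 0 <= theta <= pi *+ 2 ->
  strand_height n theta < phi <= pi / 2 ->
  open_cell (inr b : 'I_n + bool) (theta, (-1) ^+ b * phi).
Proof. by move=> tB pB; split=> //=; rewrite mulrA -expr2 sqrr_sign mul1r. Qed.

Lemma continuous_strand_height n : continuous (@strand_height n).
Proof.
move=> x; apply: cvg_norm; apply: continuous_comp; last exact: continuous_sin.
by apply: cvgM; [exact: cvg_cst|exact: cvg_id].
Qed.

Lemma closed_closed_cell n (j : 'I_n + bool) : closed (closed_cell j).
Proof.
have c1 : continuous (fun p : R * R => p.1) by move=> p; exact: cvg_fst.
have c2 : continuous (fun p : R * R => p.2) by move=> p; exact: cvg_snd.
have ch : continuous (fun p : R * R => strand_height n p.1).
  move=> p; apply: (@continuous_comp _ _ _ fst (@strand_height n)).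
    exact: cvg_fst.
  exact: continuous_strand_height.
have cc (c : R) : continuous (fun _ : R * R => c) by move=> p; exact: cvg_cst.
case: j => [k|b].
  have -> : closed_cell (inl k) = [set p : R * R | tick n k <= p.1] `&`
      ([set p | p.1 <= tick n k.+1] `&`
       [set p | `|p.2| <= strand_height n p.1]).
    by apply/seteqP; split=> p /=; rewrite -(rwP andP); tauto.
  by do ![apply: closedI|apply: closed_le_continuous => //] => p;
     apply: cvg_norm; exact: c2.
have -> : @closed_cell n (inr b) =
    ([set p : R * R | 0 <= p.1] `&` [set p | p.1 <= pi *+ 2]) `&`
    ([set p | strand_height n p.1 <= (-1) ^+ b * p.2] `&`
     [set p | (-1) ^+ b * p.2 <= pi / 2]).
  by apply/seteqP; split=> p /=; rewrite -!(rwP andP); tauto.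
have cb : continuous (fun p : R * R => (-1) ^+ b * p.2).
  by move=> p; apply: cvgM; [exact: cvg_cst|exact: c2].
by do ![apply: closedI|apply: closed_le_continuous => //].
Qed.

Lemma closed_closed_face n (j : 'I_n + bool) :
  (0 < n)%N -> closed (closed_face j).
Proof.
move=> n0; apply: compact_closed; first exact: norm_hausdorff.
apply: continuous_compact.
  by apply: continuous_subspaceT; exact: continuous_geographic.
apply: (subclosed_compact (@closed_closed_cell n j)
  (compact_setX (@segment_compact R 0 (pi *+ 2))
                (@segment_compact R (- (pi / 2)) (pi / 2)))).
by move=> p /(closed_cell_box n0)[p1 p2]; split; rewrite /= in_itv //= -ler_norml.
Qed.

Lemma faceE n (n0 : (0 < n)%N) (j : 'I_n + bool) :
  face n0 j = globe @` open_cell j.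
Proof.
apply/seteqP; split=> x.
  move=> [[_ +] [p cp xE]]; rewrite -xE => nsh; exists p => //.
  have [_ pB] := closed_cell_box n0 cp.
  have {nsh} /eqP off : `|p.2| <> strand_height n p.1.
    by move=> /(geographic_shadow n0 _ pB).
  case: j cp => [k [/andP[k1 k2] h]|b [p1 /andP[h1 h2]]].
    have {h off} h : `|p.2| < strand_height n p.1 by rewrite lt_neqAle off.
    have hp : 0 < strand_height n p.1 by apply: le_lt_trans h.
    (* the strands meet at both ends of the interval of longitudes *)
    split=> //; rewrite !lt_neqAle k1 k2 !andbT.
    apply/andP; split; apply/eqP => E.
      by move: hp; rewrite -E strand_height_tick // ltxx.
    by move: hp; rewrite E strand_height_tick // ltxx.
  split=> //; rewrite h2 andbT lt_neqAle h1 andbT; apply: contra off => /eqP E.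
  rewrite E -[X in _ == X]ger0_norm ?normrM ?normrX ?normrN1 ?expr1n ?mul1r //.
  by rewrite -E strand_height_ge0.
move=> [p op <-]; have cp := open_closed_cell op.
split; last by exists p.
split; first exact: sphere2_geographic.
have [_ pB] := closed_cell_box n0 cp.
by move=> /(geographic_shadow n0 _ pB); exact: open_cell_off op.
Qed.

Lemma face_cover n : (0 < n)%N -> @sphere2 R `<=` \bigcup_j @closed_face n j.
Proof.
move=> n0 x /geographic_onto[theta [phi [tB phiB ->]]].
have [h|h] := leP `|phi| (strand_height n theta).
  have [k kn /andP[k1 /ltW k2]] := tick_floor n0 tB.
  exists (inl (Ordinal kn)) => //; exists (theta, phi) => //.
  by split; rewrite /= ?k1.
exists (inr (phi < 0)) => //; exists (theta, phi) => //; split=> /=.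
  by case/andP: tB => -> /ltW.
have <- : `|phi| = (-1) ^+ (phi < 0)%R * phi by rewrite normrEsign.
by rewrite ltW.
Qed.

(** A point has one latitude and, off the poles, one strand height, which
    separates bigons from polygons and the polygons from each other; two bigons
    are separated by the longitude, which is strictly between 0 and 2 pi on
    every bigon and hence unique. *)
Lemma face_disjoint n (n0 : (0 < n)%N) (i j : 'I_n + bool) x :
  complement n0 x -> closed_face i x -> closed_face j x -> i = j.
Proof.
move=> Yx ix jx.
have [p ip xp] : (globe @` open_cell i) x by rewrite -(faceE n0).
have [q jq xq] : (globe @` open_cell j) x by rewrite -(faceE n0).
have [p1 p2] := closed_cell_box n0 (open_closed_cell ip).
have [q1 q2] := closed_cell_box n0 (open_closed_cell jq).
have [e2 H] := geographic_eq p2 q2 (etrans xp (esym xq)).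
have hE : `|p.2| < pi / 2 -> strand_height n p.1 = strand_height n q.1.
  by move=> /H[ec es]; exact: strand_height_congr.
have small (r : R * R) : `|r.2| < strand_height n r.1 -> `|r.2| < pi / 2.
  by move=> /lt_trans; apply; exact: strand_height_lt.
have sp := open_cell_side ip; have sq := open_cell_side jq.
case: i ip {ix} sp => [k [kp _] /= sp|b _ [sp pb]].
- case: j jq {jx} sq => [l [lq _] _|c _ [sq _]]; last first.
    by move: sq; rewrite -e2 -hE ?small // ltNge ltW.
  have [ec es] := H (small _ sp).
  have bnd (m : 'I_n) t : tick n m < t < tick n m.+1 -> 0 < t < pi *+ 2.
    move=> /andP[m1 m2]; rewrite -(tick0 n) -(tickn n0).
    by rewrite (le_lt_trans _ m1) ?tick_le // (lt_le_trans m2) ?tick_le.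
  have /andP[p10 p11] := bnd _ _ kp; have /andP[q10 q11] := bnd _ _ lq.
  congr inl; apply/val_inj/eqP => /=.
  case: (longitude_eq p1 q1 ec es) => [e|[e _]|[_ e]].
  + move: kp lq; rewrite e => /andP[k1 k2] /andP[l1 l2].
    have kl : (k < l.+1)%N by rewrite -(tick_lt _ _ n0) (lt_trans k1).
    have lk : (l < k.+1)%N by rewrite -(tick_lt _ _ n0) (lt_trans l1).
    by rewrite eqn_leq -ltnS kl -ltnS lk.
  + by rewrite e ltxx in p10.
  + by rewrite e ltxx in q10.
- case: j jq {jx} sq => [l _ /= sq|c _ [_ qc]]; last by rewrite -pb -qc e2.
  by move: sp; rewrite e2 hE ?e2 ?small // ltNge ltW.
Qed.

Lemma face_neq0 n (n0 : (0 < n)%N) (j : 'I_n + bool) : face n0 j !=set0.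
Proof.
rewrite faceE; case: j => [k|b].
  pose m := (tick n k + tick n k.+1) / 2.
  exists (geographic m 0), (m, 0) => //.
  by apply: open_cell_equator => //; exact: mid_tick.
exists (geographic 0 ((-1) ^+ b * (pi / 2))), (0, (-1) ^+ b * (pi / 2)) => //.
apply: open_cell_meridian; first by rewrite lexx mulrn_wge0 ?pi_ge0.
by rewrite lexx strand_height_lt.
Qed.

Lemma face_inj n (n0 : (0 < n)%N) : injective (face n0).
Proof.
move=> i j E; have [x jx] := face_neq0 n0 j.
have ix : face n0 i x by rewrite E.
by case: ix jx => Yx ix [_ jx]; exact: face_disjoint Yx ix jx.
Qed.

(** From a point of a bigon one goes along its meridian to the equator and then
    along the equator; in a polygon every meridian arc ends at the pole. *)
Lemma connected_face n (n0 : (0 < n)%N) (j : 'I_n + bool) :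
  connected (face n0 j).
Proof.
rewrite faceE; case: j => [k|b].
  pose m := (tick n k + tick n k.+1) / 2.
  apply: (@connected_star _ _ (geographic m 0)) => _ [[t s] /= [tk sh] <-].
  have iJ (c d : R) : is_interval [set u | c < u < d].
    move=> u v /= /andP[u1 u2] /andP[v1 v2] w /andP[w1 w2].
    by rewrite (lt_le_trans u1) // (le_lt_trans w2).
  have [|B [cB BA Bm Bt]] := @connected_path _ _ (fun u => geographic u 0)
      (globe @` open_cell (inl k)) _ m t (@continuous_parallel _ 0)
      (iJ (tick n k) (tick n k.+1)) (mid_tick k n0) tk.
    by move=> _ [u /= uk <-]; exists (u, 0) => //; exact: open_cell_equator.
  have sh' : - strand_height n t < s < strand_height n t by rewrite -ltr_norml.
  have h0 : - strand_height n t < 0 < strand_height n t.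
    by rewrite -ltr_norml normr0; apply: le_lt_trans sh.
  have [|C [cC CA C0 Cs]] := @connected_path _ _ (fun u => geographic t (1 * u))
      (globe @` open_cell (inl k)) _ 0 s (@continuous_meridian _ t 1)
      (iJ _ _) h0 sh'.
    move=> _ [u /= uh <-]; exists (t, u); last by rewrite mul1r.
    by split=> //=; rewrite ltr_norml.
  rewrite !mul1r in C0 Cs.
  exists (B `|` C); split; [|by rewrite subUset| by left|by right].
  by apply: connectedU => //; exists (geographic t 0).
apply: (@connected_star _ _ (geographic 0 ((-1) ^+ b * (pi / 2)))).
move=> _ [[t s] /= [tB sh] <-].
have -> : geographic 0 ((-1) ^+ b * (pi / 2)) =
    geographic t ((-1) ^+ b * (pi / 2)) :> 'rV[R]_3.
  apply: geographic_pole.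
  case: b {sh}; rewrite ?expr0 ?expr1 ?mul1r ?mulN1r ?cosN; exact: cos_pihalf.
have -> : s = (-1) ^+ b * ((-1) ^+ b * s) by rewrite mulrA -expr2 sqrr_sign mul1r.
apply: (@connected_path _ _ (fun u => geographic t ((-1) ^+ b * u)) _
  [set u | strand_height n t < u <= pi / 2]).
- exact: continuous_meridian.
- move=> u v /= /andP[u1 u2] /andP[v1 v2] w /andP[w1 w2].
  by rewrite (lt_le_trans u1) // (le_trans w2).
- by rewrite /= lexx strand_height_lt.
- by [].
- move=> _ [u /= uh <-]; exists (t, (-1) ^+ b * u) => //.
  exact: open_cell_meridian.
Qed.

Lemma torus_regions n (n0 : (0 < n)%N) :
  regions (torus_projection R n0) = range (face n0).
Proof.
have comp j x : face n0 j x -> connected_component (complement n0) x = face n0 j.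
  move=> [Yx jx]; apply: connected_component_partition => //.
  - by move=> i; exact: closed_closed_face.
  - by move=> i; exact: connected_face.
  - by move=> y [sy _]; exact: face_cover n0 _ sy.
  - by move=> i k y; exact: face_disjoint.
apply/seteqP; split=> U.
  move=> [x Yx <-]; have [j _ jx] := face_cover n0 Yx.1.
  by exists j => //; apply/esym/comp.
move=> [j _ <-]; have [x jx] := face_neq0 n0 j.
by exists x; [case: jx|exact: comp].
Qed.

(** * Crossings and the boundaries of the faces *)

Lemma torus_crossing n (n0 : (0 < n)%N) c :
  crossing (torus_projection R n0) c <->
  exists k : 'I_n, c = geographic (tick n k) 0.
Proof.
have pihalf0 : 0 < pi / 2 :> R by rewrite divr_gt0 ?pi_gt0.
split=> [[p [q [pP qP pq <- E]]]|[k ->]].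
  have [s0 _ _ _] := torus_curve_eq pP qP pq (esym E).
  rewrite /= /torus_curve /torus_latitude s0 mulr0.
  have h0 : strand_height n (torus_longitude n p.2) = 0.
    by rewrite /strand_height /phase s0 normr0.
  move: (torus_longitude n p.2) h0 => lon h0.
  (* normalizing the longitude into one turn makes its floor a crossing *)
  have [theta [phi [tB phiB gE]]] := geographic_onto (sphere2_geographic lon 0).
  have [|e H] := geographic_eq _ phiB gE; first by rewrite normr0 ltW.
  have [|ec es] := H _; first by rewrite normr0.
  rewrite gE -e; have [k kn /andP[k1 k2]] := tick_floor n0 tB.
  exists (Ordinal kn); congr geographic; apply/eqP; rewrite eq_le k1 andbT leNgt.
  apply/negP => k1'; move: h0; rewrite (strand_height_congr n ec es) => /eqP.
  by rewrite gt_eqF // (@strand_height_between_ticks n k) // k1'.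
have nR : n%:R != 0 :> R by rewrite pnatr_eq0 -lt0n.
have curveE (i : 'I_(~~ odd n).+1) t :
    torus_longitude n t = tick n k \/ torus_longitude n t = tick n k + pi *+ 2 ->
    torus_curve i t = geographic (tick n k) 0.
  have sk : sin (phase n (tick n k)) = 0.
    by apply/eqP; rewrite -normr_eq0 -/(strand_height _ _) strand_height_tick.
  rewrite /torus_curve /torus_latitude -/(phase n _) => -[] ->.
    by rewrite sk mulr0.
  by rewrite phase_turn (alternatingn (@sinDpi R)) sk !mulr0 geographic_turn.
have k0 : 0 <= k%:R / n%:R :> R by rewrite divr_ge0.
have k1 : k%:R / n%:R < 1 :> R.
  by rewrite ltr_pdivrMr ?ltr0n // mul1r ltr_nat.
have [on|en] := boolP (odd n).
  have lon1 : torus_longitude n (k%:R / n%:R / 2) = tick n k.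
    by rewrite /torus_longitude /tick on /=; field.
  have lon2 :
      torus_longitude n (k%:R / n%:R / 2 + 2^-1) = tick n k + pi *+ 2.
    by rewrite /torus_longitude /tick on /=; field.
  exists (ord0, k%:R / n%:R / 2), (ord0, k%:R / n%:R / 2 + 2^-1); split.
  - by rewrite /parameters /=; apply/andP; split; lra.
  - by rewrite /parameters /=; apply/andP; split; lra.
  - by case; lra.
  - by apply: curveE; left.
  - by apply: curveE; right.
have i1 : (1 < (~~ odd n).+1)%N by rewrite en.
have lonE : torus_longitude n (k%:R / n%:R) = tick n k.
  by rewrite /torus_longitude /tick (negPf en) mulr1n -!(mulr_natr pi); field.
exists (ord0, k%:R / n%:R), (Ordinal i1, k%:R / n%:R); split.
- by rewrite /parameters /= k0.
- by rewrite /parameters /= k0.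
- by case.
- by apply: curveE; left.
- by apply: curveE; left.
Qed.

Lemma val_ordS n (i : 'I_n) :
  val (ordS i) = i.+1 \/ val (ordS i) = 0%N /\ i.+1 = n.
Proof.
rewrite /=; have := ltn_ord i; rewrite leq_eqVlt => /orP[/eqP ->|im].
  by right; rewrite modnn.
by left; rewrite modn_small.
Qed.

Lemma geographic_tick_ordS n (n0 : (0 < n)%N) (i : 'I_n) phi :
  geographic (tick n i.+1) phi = geographic (tick n (ordS i)) phi.
Proof.
case: (val_ordS i) => [->//|[-> ->]].
by rewrite tickn // tick0 -[pi *+ 2]add0r geographic_turn.
Qed.

(** The longitude of a crossing is unique in one turn, except that crossing 0
    also has longitude 2 pi, where the last bigon ends. *)
Lemma closed_face_corner n (j : 'I_n + bool) (k : 'I_n) : (0 < n)%N ->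
  closed_face j (geographic (tick n k) 0) -> corner j k.
Proof.
move=> n0 [[t s] cp /=] /esym gE; have [/= tB sB] := closed_cell_box n0 cp.
case: j cp => [i [/= /andP[t1 t2] _]|//].
have [|_ H] := geographic_eq _ sB gE; first by rewrite normr0 divr_ge0 ?pi_ge0.
have [|ec es] := H; first by rewrite normr0 divr_gt0 ?pi_gt0.
case: (longitude_eq (tick_turn k) tB ec es) t1 t2 => [<-|[k0 ->]|[kn _]].
- rewrite !tick_le // => ik; rewrite leq_eqVlt => /orP[/eqP ki|ki].
    apply/orP; right; apply/eqP/val_inj; case: (val_ordS i) => [->//|[_ ni]].
    by have := ltn_ord k; rewrite ki ni ltnn.
  by apply/orP; left; apply/eqP/val_inj/eqP; rewrite eqn_leq ik -ltnS ki.
- rewrite -(tickn n0) !tick_le // => _ ni; apply/orP; right; apply/eqP/val_inj.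
  have -> : val k = 0%N.
    by apply/eqP; rewrite -leqn0 -(tick_le _ _ n0) k0 tick0.
  case: (val_ordS i) => [iE|[->//]]; have := ltn_ord (ordS i).
  by rewrite /= in iE *; rewrite iE ltnNge ni.
- by have := ltn_ord k; rewrite -(tick_lt _ _ n0) kn tickn // ltxx.
Qed.

(** A bigon reaches its two crossings along the equator, a polygon reaches
    every crossing along the meridian of the crossing. *)
Lemma closure_face_corner n (n0 : (0 < n)%N) (j : 'I_n + bool) (k : 'I_n) :
  corner j k -> closure (face n0 j) (geographic (tick n k) 0).
Proof.
rewrite faceE; case: j => [i|b] /= ik.
  have lt_tick : tick n i < tick n i.+1 by rewrite tick_lt.
  have [cl1 cl2] := closure_itvoo lt_tick.
  have sub : (fun t => geographic t 0) @` `]tick n i, tick n i.+1[ `<=`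
      globe @` open_cell (inl i).
    move=> _ [t /= tI <-]; exists (t, 0) => //.
    by apply: open_cell_equator => //; rewrite in_itv in tI.
  case/orP: ik => /eqP ->; last rewrite -geographic_tick_ordS //;
    apply: (closureS sub).
    exact: (closure_continuous_image (@continuous_parallel _ 0) cl1).
  exact: (closure_continuous_image (@continuous_parallel _ 0) cl2).
have [cl _] := closure_itvoo (@strand_height_lt n (tick n k)).
have sub : (fun u => geographic (tick n k) ((-1) ^+ b * u)) @`
      `]strand_height n (tick n k), (pi / 2)[ `<=`
    globe @` open_cell (inr b : 'I_n + bool).
  move=> _ [u /= uI <-]; exists (tick n k, (-1) ^+ b * u) => //.
  apply: open_cell_meridian; first exact: tick_turn.
  by move: uI; rewrite in_itv /= => /andP[-> /ltW].
apply: (closureS sub).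
have := closure_continuous_image
  (@continuous_meridian _ (tick n k) ((-1) ^+ b)) cl.
by rewrite strand_height_tick // mulr0.
Qed.

Lemma frontier_face n (n0 : (0 < n)%N) (j : 'I_n + bool) (k : 'I_n) :
  frontier (face n0 j) (geographic (tick n k) 0) <-> corner j k.
Proof.
split=> [[cl _]|jk].
  apply: closed_face_corner => //; apply: closed_closed_face => //.
  by apply: closureS cl => x [].
split; first exact: closure_face_corner.
(* the crossing itself lies on the sphere and outside the face *)
apply: subset_closure; split; first exact: sphere2_geographic.
case=> -[_ nsh] _; apply: nsh; apply/(geographic_shadow n0).
  by rewrite normr0 divr_ge0 ?pi_ge0.
by rewrite normr0 strand_height_tick.
Qed.

Lemma torus_share_crossing n (n0 : (0 < n)%N) (i j : 'I_n + bool) :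
  share_crossing (torus_projection R n0) (face n0 i) (face n0 j) <->
  share_corner i j.
Proof.
split=> [[_ [/torus_crossing[k ->]]]|/existsP[k /andP[ik jk]]].
  move=> /frontier_face ik /frontier_face jk.
  by apply/existsP; exists k; rewrite ik.
exists (geographic (tick n k) 0).
by split; [apply/torus_crossing; exists k|exact/frontier_face|exact/frontier_face].
Qed.

Lemma I_generating_torus n (n0 : (0 < n)%N) : (1 < n)%N ->
  I_generating (torus_projection R n0) =
  \sum_(C : {set 'I_n} | cyclic_independent C) 'X^#|C| + 'X *+ 2.
Proof.
move=> n1; rewrite -independent_poly //.
apply: I_generating_finite; first exact: face_inj.
  exact: torus_regions.
exact: torus_share_crossing.
Qed.

End Torus.

Theorem proposition7 (R : realType) (f : nat -> {poly int})
  (hf : forall (n : nat) (n_gt0 : (0 < n)%N),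
     f n = I_generating (torus_projection R n_gt0))
  (n : nat) (hn : (4 <= n)%N) :
  f n - f (n - 1)%N - 'X * f (n - 2)%N = - (2%:R *: 'X^2).
Proof.
case: n hn => [|[|[|[|m]]]] // _; rewrite subn1 subn2 /=.
rewrite (hf _ (ltn0Sn m.+3)) (hf _ (ltn0Sn m.+2)) (hf _ (ltn0Sn m.+1)).
rewrite !I_generating_torus // !cyclic_independent_poly !big_bool /=.
by rewrite !walk_polySS scaler_nat mulr2n; ring.
Qed.
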